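(* Let $U$ be a generalized Urysohn metric space. If $U$ is $\omega$-homogeneous, then the group $\mathrm{Iso}(U)$ has the fixed point on compacta property.
   Context: A metric space $U$ is a generalized Urysohn space if whenever $A\subseteq U$ is a finite metric subspace and $A'=A\cup\{a\}$ is an arbitrary one-point metric space extension of $A$, the embedding $A\hookrightarrow U$ extends to an isometric embedding $A'\hookrightarrow U$ (no separability is assumed). $U$ is $\omega$-homogeneous if every isometry between two finite subspaces of $U$ extends to an isometry of $U$ onto itself. $\mathrm{Iso}(U)$ is the group of all isometries of $U$ onto itself, with the topology of pointwise convergence on $U$. A topological group has the fixed point on compacta property if every continuous action of it on a (nonempty) compact space has a fixed point. *)

(* Defs.v *)
From HB Require Import structures.
From mathcomp Require Import all_boot all_order all_algebra.
From mathcomp Require Import all_classical all_reals.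
From mathcomp Require Import topology.

Set Implicit Arguments.
Unset Strict Implicit.
Unset Printing Implicit Defensive.

Import Order.TTheory GRing.Theory Num.Theory.

Local Open Scope classical_set_scope.
Local Open Scope ring_scope.

HB.mixin Record isTopologicalGroup G & Topological G & Group G := {
  mulg_continuous : continuous (fun p : G * G => (p.1 * p.2)%g) ;
  invg_continuous : continuous (fun g : G => (g^-1)%g)
}.

#[short(type="topologicalGroupType")]
HB.structure Definition TopologicalGroup :=
  { G of Topological G & Group G & isTopologicalGroup G }.

Definition continuous_action (G : topologicalGroupType) (X : topologicalType)
    (act : G -> X -> X) : Prop :=
  [/\ forall x, act 1%g x = x,
      forall g h x, act (g * h)%g x = act g (act h x)
    & continuous (fun p : G * X => act p.1 p.2)].

(* Compact spaces are Hausdorff: otherwise every nontrivial group would act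
   without fixed points on itself with the indiscrete topology. *)
Definition fixed_point_on_compacta (G : topologicalGroupType) : Prop :=
  forall X : topologicalType,
    [set: X] !=set0 -> compact [set: X] -> hausdorff_space X ->
  forall act : G -> X -> X, continuous_action act ->
  exists x : X, forall g : G, act g x = x.

Section metric_subspace.
Context {R : realType} {U : metricType R} (A : set U).

Let subdist (x y : A) : R := mdist (\val x) (\val y).

Let subdist_ge0 x y : 0 <= subdist x y.
Proof. exact: mdist_ge0. Qed.

Let subdist_positivity x y : subdist x y = 0 -> x = y.
Proof. by move=> /mdist_positivity/val_inj. Qed.

Let ballEsubdist x d : ball x d = [set y | subdist x y < d].
Proof.
have -> : ball x d = [set y : A | ball (\val x) d (\val y)] by [].
by rewrite ballEmdist.
Qed.

HB.instance Definition _ := @PseudoMetric_isMetric.Build R A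
  subdist subdist_ge0 subdist_positivity ballEsubdist.

End metric_subspace.

Definition isometric_embedding (R : realType) (U V : metricType R)
    (f : U -> V) : Prop :=
  forall x y, mdist (f x) (f y) = mdist x y.

Definition isometry_onto (R : realType) (U V : metricType R)
    (f : U -> V) : Prop :=
  isometric_embedding f /\ range f = [set: V].

Definition generalized_Urysohn (R : realType) (U : metricType R) : Prop :=
  forall A : set U, finite_set A ->
  forall (A' : metricType R) (i : A -> A') (a : A'),
    isometric_embedding i -> ~ range i a -> range i `|` [set a] = [set: A'] ->
  exists j : A' -> U,
    isometric_embedding j /\ forall x : A, j (i x) = \val x.

Definition omega_homogeneous (R : realType) (U : metricType R) : Prop :=
  forall A B : set U, finite_set A -> finite_set B ->
  forall f : A -> B, isometry_onto f ->
  exists2 g : U -> U, isometry_onto g & forall x : A, g (\val x) = \val (f x).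

Definition isometries (R : realType) (U : metricType R) : set {ptws U -> U} :=
  [set f : U -> U | isometry_onto f].

Arguments isometries {R} U.

Definition Iso (R : realType) (U : metricType R) : Type :=
  set_type (isometries U).

(* The subspace topology induced by the topology of pointwise convergence. *)
HB.instance Definition _ (R : realType) (U : metricType R) :=
  Topological.copy (Iso U) (set_type (isometries U)).

Section Iso_group.
Context {R : realType} {U : metricType R}.

Definition Iso_fun (f : Iso U) : U -> U := \val f.
Coercion Iso_fun : Iso >-> Funclass.

Definition mkIso (f : U -> U) (fP : isometry_onto f) : Iso U :=
  exist _ f (mem_set fP).

Lemma Iso_onto (f : Iso U) : isometry_onto f.
Proof. exact: set_valP f. Qed.

Lemma Iso_ext (f g : Iso U) : f =1 g -> f = g.
Proof. by move=> /funext fg; apply: val_inj. Qed.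

Lemma Iso_mdist (f : Iso U) x y : mdist (f x) (f y) = mdist x y.
Proof. exact: (Iso_onto f).1. Qed.

Lemma Iso_inj (f : Iso U) : injective f.
Proof.
by move=> x y fxy; apply: mdist_positivity; rewrite -(Iso_mdist f) fxy mdistxx.
Qed.

Lemma Iso_surj (f : Iso U) y : exists x, f x = y.
Proof.
have : [set: U] y by [].
by rewrite -(Iso_onto f).2 => -[x _ <-]; exists x.
Qed.

Lemma id_onto : isometry_onto (@id U).
Proof. by split=> //; apply/seteqP; split=> // x _; exists x. Qed.

Lemma comp_onto (f g : Iso U) : isometry_onto (f \o g).
Proof.
split=> [x y|]; first by rewrite /= !Iso_mdist.
apply/seteqP; split=> // z _.
by have [y <-] := Iso_surj f z; have [x <-] := Iso_surj g y; exists x.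
Qed.

Definition Iso_inv_fun (f : Iso U) (y : U) : U := sval (cid (Iso_surj f y)).

Lemma Iso_inv_funK (f : Iso U) : cancel (Iso_inv_fun f) f.
Proof. by move=> y; rewrite /Iso_inv_fun; case: cid. Qed.

Lemma inv_onto (f : Iso U) : isometry_onto (Iso_inv_fun f).
Proof.
split=> [x y|]; first by rewrite -(Iso_mdist f) !Iso_inv_funK.
apply/seteqP; split=> // x _; exists (f x) => //.
by apply: (@Iso_inj f); rewrite Iso_inv_funK.
Qed.

Definition Iso_one : Iso U := mkIso id_onto.
Definition Iso_mul (f g : Iso U) : Iso U := mkIso (comp_onto f g).
Definition Iso_inv (f : Iso U) : Iso U := mkIso (inv_onto f).

Lemma Iso_mulA : associative Iso_mul.
Proof. by move=> f g h; apply: Iso_ext. Qed.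

Lemma Iso_mul1g : left_id Iso_one Iso_mul.
Proof. by move=> f; apply: Iso_ext. Qed.

Lemma Iso_mulg1 : right_id Iso_one Iso_mul.
Proof. by move=> f; apply: Iso_ext. Qed.

Lemma Iso_mulgV : right_inverse Iso_one Iso_inv Iso_mul.
Proof. by move=> f; apply: Iso_ext => x; exact: Iso_inv_funK. Qed.

Lemma Iso_mulVg : left_inverse Iso_one Iso_inv Iso_mul.
Proof.
by move=> f; apply: Iso_ext => x; apply: (@Iso_inj f); exact: Iso_inv_funK.
Qed.

HB.instance Definition _ :=
  isGroup.Build (Iso U) Iso_mulA Iso_mul1g Iso_mulg1 Iso_mulVg Iso_mulgV.

Import metricType_numDomainType.

Lemma Iso_cvgP (F : set_system (Iso U)) (f : Iso U) : Filter F ->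
  F --> f <-> forall x, (fun g : Iso U => g x) @ F --> f x.
Proof.
move=> FF.
have ptP := pointwise_cvgP (V := U) (f : U -> U)
  (fmap_filter (Iso_fun : Iso U -> {ptws U -> U}) FF).
split=> [Ff|/ptP ptFf].
  by apply/ptP => A /(@initial_continuous _ _ set_val f)/Ff.
move=> A [_ [[B Bop <-] Bf /filterS]]; apply.
by apply: ptFf; apply: open_nbhs_nbhs.
Qed.

Lemma Iso_mul_continuous : continuous (fun p : Iso U * Iso U => (p.1 * p.2)%g).
Proof.
move=> [f g]; apply/Iso_cvgP => x; apply/cvgrPdist_lt => e e0.
have e20 : 0 < e / 2 by rewrite divr_gt0.
have /Iso_cvgP/(_ (Iso_fun g x))/cvgrPdist_lt/(_ _ e20) ff : nbhs f --> f.
  by [].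
have /Iso_cvgP/(_ x)/cvgrPdist_lt/(_ _ e20) gg : nbhs g --> g by [].
exists ([set f' : Iso U | mdist (Iso_fun f (Iso_fun g x))
                                (f' (Iso_fun g x)) < e / 2],
        [set g' : Iso U | mdist (Iso_fun g x) (g' x) < e / 2]) => //.
move=> [f' g'] /= [ff' gg'].
rewrite (le_lt_trans (metric_triangle _ (Iso_fun f' (Iso_fun g x)) _))//.
by rewrite (splitr e) ltrD// Iso_mdist.
Qed.

Lemma Iso_inv_continuous : continuous (fun f : Iso U => (f^-1)%g).
Proof.
move=> f; apply/(Iso_cvgP _ (fmap_filter _ (nbhs_filter f))) => x.
apply/cvgrPdist_lt => e e0.
pose y := Iso_fun (Iso_inv f) x.
have /Iso_cvgP/(_ y)/cvgrPdist_lt/(_ _ e0) : nbhs f --> f by [].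
apply: filterS => g; rewrite Iso_inv_funK.
by rewrite -{1}(Iso_inv_funK g x) Iso_mdist metric_sym.
Qed.

HB.instance Definition _ :=
  isTopologicalGroup.Build (Iso U) Iso_mul_continuous Iso_inv_continuous.

End Iso_group.

(* Main.v *)
Require Import Defs.
From HB Require Import structures.
From mathcomp Require Import all_boot all_order all_algebra all_fingroup.
From mathcomp Require Import all_classical all_reals.
From mathcomp Require Import topology.
From mathcomp Require Import ring lra.

(** Let [Iso U] act on a compact space [X] without fixed points. By
    compactness finitely many open sets [W_1, ..., W_m] cover [X], with isometries
    [g_i] such that [g_i W_i] is disjoint from [W_i]. Pick [x0] in [X]
    and colour an isometry [a] by an [i] such that [a x0] is in [W_i]. It suffices
    to find a single isometry [h] and a colour [i] such that [h] and all of
    [g_1 h, ..., g_m h] are close to isometries of colour [i]: then [h x0] and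
    [g_i h x0] are both in [W_i] (after shrinking the [W_i] to allow for the error
    in closeness), which is absurd. This Ramsey property of the group is
    [Iso_ramsey]; closeness means that [a] and [g h] agree up to [delta] after
    inversion on a finite subset of [U].

    The Ramsey property comes from concentration of measure on powers [Q^n] of
    finite groups. A Lipschitz function on [Q^n] for the Hamming distance has
    variance at most [n] ([efron_stein]), which is negligible with respect to
    [n^2]. Applied to the distances to the colour classes of a finite colouring
    of [Q^n], this gives an [h] all of whose right translates by given elements of
    [Q] are close to the colour class of [h] ([shift_ramsey]).

    To carry this over to [Iso U], the finitely many isometries in question are
    replaced by elements of a finite group. The pullback of the distance of [U]
    along an orbit map [g |-> g x0] is a left-invariant pseudometric on [Iso U],
    and finitely many of its values are realized (the value 0 only up to a small
    error) by a left-invariant metric on a finite group [Q]: this is [finite_norm], which rests on the residual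
    finiteness argument of [finite_model]. The group [Q^n] with the mean of the
    distances of the coordinates is a finite metric space, so it embeds in [U]
    ([embed_finType]), and the homogeneity of [U] turns isometric copies of finite
    sets within [Q^n] into isometries of [U] ([extend_isometry]). *)

Set Implicit Arguments.
Unset Strict Implicit.
Unset Printing Implicit Defensive.

Import Order.TTheory GRing.Theory Num.Theory.

Local Open Scope ring_scope.

(** * Finite models of finitely many group elements *)

Section PartialInjections.
Context {T : finType}.

(** By induction on the domain: a permutation that is right on all of [D] but
    [z] is corrected at [z] by a transposition, which touches no other value
    because [f] is injective. *)
Lemma perm_extend (D : {set T}) (f : T -> T) : {in D &, injective f} ->
  exists s : {perm T}, {in D, s =1 f}.
Proof.
have [m] := ubnP #|D|; elim: m D => // m IH D Dm fI.
have [->|[z zD]] := set_0Vmem D.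
  by exists 1%g => z; rewrite finset.in_set0.
have cD : #|D| = #|D :\ z|.+1 by rewrite (cardsD1 z) zD.
have [|x y xD yD|s sf] := IH (D :\ z).
- by rewrite cD in Dm.
- by apply: fI; [move: xD|move: yD]; rewrite !inE => /andP[].
exists (s * tperm (s z) (f z))%g => x xD; rewrite permM.
have [->|xz] := eqVneq x z; first by rewrite tpermL.
have sx : s x = f x by apply: sf; rewrite !inE xz.
rewrite sx tpermD//; last by apply: contra_neq xz => /esym; exact: fI.
by rewrite -sx (inj_eq perm_inj) eq_sym.
Qed.

End PartialInjections.

(** A letter is a group element with a flag that says whether it is inverted;
    the same word can then be evaluated in [G] (with [phi := id]) and in a
    finite group in which [phi] interprets the letters. *)
Definition letter {G : Type} {H : groupType} (phi : G -> H) (e : bool * G) : H :=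
  if e.1 then (phi e.2)^-1%g else phi e.2.

Definition word_eval {G : Type} {H : groupType} (phi : G -> H)
    (w : seq (bool * G)) : H := foldr (fun e h => (letter phi e * h)%g) 1%g w.

Lemma word_eval_cat (G : Type) (H : groupType) (phi : G -> H) w1 w2 :
  word_eval phi (w1 ++ w2) = (word_eval phi w1 * word_eval phi w2)%g.
Proof. by elim: w1 => [|e w IH] /=; rewrite ?mul1g// IH mulgA. Qed.

Section FiniteModel.
Context {G : groupType}.

Fixpoint word_ball (A : seq G) (k : nat) : seq G :=
  if k is k'.+1 then
    word_ball A k' ++
    [seq (z * a)%g | z <- word_ball A k', a <- A ++ [seq a^-1%g | a <- A]]
  else [:: 1%g].

Lemma word_ball_le A k m : (k <= m)%N -> {subset word_ball A k <= word_ball A m}.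
Proof.
elim: m k => [|m IH] k; first by rewrite leqn0 => /eqP ->.
rewrite leq_eqVlt => /predU1P[-> //|]; rewrite ltnS => /IH km z /km zm.
by rewrite /= mem_cat zm.
Qed.

Lemma word_ball_letter A k e z : e.2 \in A -> z \in word_ball A k ->
  (z * letter id e)%g \in word_ball A k.+1.
Proof.
move=> eA zk; rewrite /= mem_cat; apply/orP; right.
apply/allpairsP; exists (z, letter id e); split=> //=.
rewrite mem_cat /letter; case: e.1; last by rewrite eA.
by rewrite map_f ?orbT.
Qed.

(** The classical argument for the residual finiteness of free groups. On the
    ball of radius [M], right multiplication by [g] is a partial injection;
    complete it to a permutation [phi g] of the ball. A word of length at most
    [M] moves the unit along a path that never leaves the ball, so that the
    completion is never seen and the image of the unit is the value of the
    word. *)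
Lemma finite_model (A : seq G) (M : nat) :
  exists (Q : finGroupType) (phi : G -> Q) (E : Q -> G),
    forall w, all (fun e => e.2 \in A) w -> (size w <= M)%N ->
      E (word_eval phi w) = word_eval id w.
Proof.
(* Permutations compose from left to right, hence right multiplication. *)
pose B := seq_sub (word_ball A M).
have B1 : 1%g \in word_ball A M by apply: (@word_ball_le A 0); rewrite ?inE.
pose o : B := SeqSub B1.
pose step (g : G) (z : B) : B := insubd o (val z * g)%g.
have stepE g z : (val z * g)%g \in word_ball A M -> val (step g z) = (val z * g)%g.
  by move=> zg; rewrite val_insubd zg.
have /choice[phi phiE] : forall g, exists s : {perm B},
    {in [set z : B | (val z * g)%g \in word_ball A M]%SET, s =1 step g}.
  move=> g; apply: perm_extend => x y; rewrite !inE => xg yg /(congr1 val).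
  by rewrite !stepE// => /mulIg; exact: val_inj.
exists {perm B}, phi, (fun q : {perm B} => val (q o)).
have phiP g (z : B) : (val z * g)%g \in word_ball A M ->
    val (phi g z) = (val z * g)%g.
  by move=> zg; rewrite phiE ?inE// stepE.
have letterP e (z : B) : (val z * letter id e)%g \in word_ball A M ->
    val (letter phi e z) = (val z * letter id e)%g.
  rewrite /letter; case: e.1 => zg; last exact: phiP.
  pose z' : B := SeqSub zg.
  have /val_inj <- : val (phi e.2 z') = val z.
    by rewrite phiP /= ?mulgKV//; exact: valP.
  by rewrite permK /= phiP /= ?mulgK// mulgKV; exact: valP.
suff H w k (z : B) : all (fun e => e.2 \in A) w -> (size w + k <= M)%N ->
    val z \in word_ball A k -> val (word_eval phi w z) = (val z * word_eval id w)%g.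
  move=> w wA wM; rewrite (H w 0%N o)//= ?mul1g ?inE//.
  by rewrite addn0.
elim: w k z => [|e w IH] k z /=; first by rewrite perm1 mulg1.
move=> /andP[eA wA]; rewrite addSnnS => wM zk.
have zek := word_ball_letter eA zk.
have zeM : (val z * letter id e)%g \in word_ball A M.
  by apply: word_ball_le zek; rewrite (leq_trans _ wM)// leq_addl.
by rewrite permM (IH k.+1) ?letterP// mulgA.
Qed.

End FiniteModel.

(** * Finite models of a left-invariant pseudometric *)

(** The left-invariant pseudometrics on [G] are the functions
    [(g, h) |-> L (g^-1 * h)] for such an [L]. *)
Record length_function {R : realType} {G : groupType} (L : G -> R) : Prop :=
  LengthFunction {
    length1 : L 1%g = 0 ;
    lengthV : forall g, L (g^-1)%g = L g ;
    lengthM : forall g h, L (g * h)%g <= L g + L h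
  }.

Lemma length_ge0 (R : realType) (G : groupType) (L : G -> R) g :
  length_function L -> 0 <= L g.
Proof.
move=> LL; have := lengthM LL g g^-1%g.
by rewrite mulgV (length1 LL) (lengthV LL); lra.
Qed.

Section FiniteNorm.
Context {R : realType} {G : groupType} (L : G -> R) (LL : length_function L).

Definition word_inv (w : seq (bool * G)) := rev [seq (~~ e.1, e.2) | e <- w].

Lemma word_eval_inv (H : groupType) (phi : G -> H) w :
  word_eval phi (word_inv w) = ((word_eval phi w)^-1)%g.
Proof.
elim: w => [|e w IH]; first by rewrite /word_inv /= invg1.
rewrite /word_inv /= rev_cons -cats1 word_eval_cat -/(word_inv w) IH /=.
by rewrite mulg1 invgM /letter /=; case: e.1; rewrite ?invgK.
Qed.

Lemma word_invK : involutive word_inv.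
Proof.
move=> w; rewrite /word_inv map_rev revK -map_comp -[RHS]map_id.
by apply: eq_map => -[b g]; rewrite /= negbK.
Qed.

(** [N] is the word length on a finite model [Q] for the generators [Ws], a word
    [w] having weight [max (L w) eta], truncated at a large constant [D]. The
    positive [eta] bounds the number of generators in a product of total weight
    less than [D]; a model that is faithful to words of the corresponding length
    turns an equality in [Q] between such a product and some [w] in [Ws] into an
    equality in [G], where the triangle inequality for [L] gives
    [L w <= N w]. *)
Lemma finite_norm (Ws : seq (seq (bool * G))) (eta : R) : 0 < eta ->
  exists (Q : finGroupType) (phi : G -> Q) (N : Q -> R),
    [/\ length_function N, forall q, N q = 0 -> q = 1%g &
      forall w, w \in Ws -> L (word_eval id w) <= N (word_eval phi w) <=
                            Num.max (L (word_eval id w)) eta].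
Proof.
move=> eta0; (* Closing [Ws] under inverses makes [N] symmetric. *)
pose Ws' := Ws ++ [seq word_inv w | w <- Ws].
have WsV w : w \in Ws' -> word_inv w \in Ws'.
  rewrite !mem_cat => /orP[wW|/mapP[v vW ->]].
    by rewrite (map_f word_inv wW) orbT.
  by rewrite word_invK vW.
pose A := [seq e.2 | e <- flatten Ws'].
pose m := \max_(w <- Ws') size w.
pose D := eta + \sum_(w <- Ws') L (word_eval id w).
have LD w : w \in Ws' -> L (word_eval id w) <= D.
  move=> wW; rewrite /D (big_rem w)//= addrCA lerDl addr_ge0//; first exact: ltW.
  by rewrite sumr_ge0// => *; exact: length_ge0.
have D0 : eta <= D.
  by rewrite /D lerDl sumr_ge0// => *; exact: length_ge0.
(* [K] bounds the number of words, and [m] the size of each, in any product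
   of weight below [D]; the last [m] letters are for the word it is compared to. *)
pose K := (Num.truncn (D / eta)).+1.
have [Q [phi [E HE]]] := finite_model A (K * m + m).
pose wt w := Num.max (L (word_eval id w)) eta.
have wt_eta w : eta <= wt w by rewrite le_max lexx orbT.
pose cost (u : seq (seq (bool * G))) := \sum_(w <- u) wt w.
have costD u : cost u < D -> (size u <= K)%N.
  move=> uD; rewrite -(ler_nat R); apply: ltW.
  apply: le_lt_trans (truncnS_gt (D / eta)).
  rewrite ler_pdivlMr// (le_trans _ (ltW uD))// mulr_natl -sum1_size -sumrMnr.
  by apply: ler_sum => w _; rewrite mulr1n.
pose S q : set R := [set r | r = D \/ exists u,
  [/\ all [in Ws'] u, word_eval phi (flatten u) = q & r = cost u]]%classic.
have cost_ge0 u : 0 <= cost u.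
  by rewrite sumr_ge0// => w _; rewrite (le_trans _ (wt_eta _))// ltW.
have S0 q : nonempty (S q) by exists D; left.
have Slb q : has_lbound (S q).
  exists 0 => r [->|[u [_ _ ->]]//]; exact: le_trans (ltW eta0) D0.
pose N q := inf (S q).
have NS q r : S q r -> N q <= r by move=> Sr; apply: ge_inf.
have SN q r : (forall s, S q s -> r <= s) -> r <= N q.
  by move=> rS; apply: lb_le_inf.
have N_ge0 q : 0 <= N q.
  by apply: (SN) => r [->|[u [_ _ ->]]//]; exact: le_trans (ltW eta0) D0.
have NV_le q : N q^-1%g <= N q.
  apply: (SN) => r [->|[u [uW uq ->]]]; apply: (NS); first by left.
  right; exists (rev (map word_inv u)); split.
  - by rewrite all_rev all_map; apply: sub_all uW => w; exact: WsV.
  - rewrite -uq; elim: u {uW uq} => [|w u IH] /=; first by rewrite invg1.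
    rewrite rev_cons -cats1 flatten_cat /= cats0 !word_eval_cat IH invgM.
    by rewrite word_eval_inv.
  - rewrite /cost [RHS](perm_big (map word_inv u)) ?perm_rev// big_map.
    by apply: eq_bigr => w _; rewrite /wt word_eval_inv (lengthV LL).
exists Q, phi, N; split.
- split.
  + apply/eqP; rewrite eq_le N_ge0 andbT; apply: (NS); right; exists [::].
    by rewrite /cost big_nil.
  + by move=> q; apply/eqP; rewrite eq_le NV_le -{1}[q]invgK NV_le.
  + move=> p q; rewrite -lerBlDr; apply: (SN) => a Sa.
    rewrite lerBlDr addrC -lerBlDr; apply: (SN) => b Sb; rewrite lerBlDr.
    case: Sa => [->|[u [uW up ->]]].
      rewrite (@le_trans _ _ D)//; first by apply: (NS); left.
      rewrite lerDr; case: Sb => [->|[v [_ _ ->]]//].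
      exact: le_trans (ltW eta0) D0.
    case: Sb => [->|[v [vW vq ->]]].
      by rewrite (@le_trans _ _ D) ?lerDl//; apply: (NS); left.
    apply: (NS); right; exists (u ++ v); split.
    * by rewrite all_cat uW.
    * by rewrite flatten_cat word_eval_cat up vq.
    * by rewrite /cost big_cat addrC.
- move=> q Nq0; apply: contrapT => q1.
  suff : eta <= N q by rewrite Nq0 leNgt eta0.
  apply: (SN) => r [->//|[[|w u] [_ uq ->]]]; first by case: q1.
  rewrite /cost big_cons -[leLHS]addr0 lerD//; exact: cost_ge0.
- move=> w wW.
  have wW' : w \in Ws' by rewrite mem_cat wW.
  apply/andP; split; last first.
    apply: (NS); right; exists [:: w]; split.
    + by rewrite /= wW'.
    + by rewrite /= cats0.
    + by rewrite /cost big_seq1.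
  apply: (SN) => r [->|[u [uW uw ->]]]; first exact: LD.
  case: (leP D (cost u)) => [|/costD uK]; first by apply: le_trans; exact: LD.
  have wm v : v \in Ws' -> (size v <= m)%N by move=> vW; exact: leq_bigmax_seq.
  have wA v : v \in Ws' -> all (fun e => e.2 \in A) v.
    move=> vW; apply/allP => e ev; apply: map_f.
    by apply/flattenP; exists v.
  have um : (size (flatten u) <= size u * m)%N.
    elim: u uW {uw uK} => //= v u IH /andP[vW uW].
    by rewrite size_cat mulSn leq_add ?wm ?IH.
  have -> : word_eval id w = word_eval id (flatten u).
    rewrite -(HE w) ?wA//; last by rewrite (leq_trans (wm _ wW')) ?leq_addl.
    rewrite -uw HE//.
      elim: u uW {uw uK um} => //= v u IH /andP[vW uW].
      by rewrite all_cat wA// IH.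
    by rewrite (leq_trans um)// (@leq_trans (K * m))%N ?leq_addr// leq_mul2r uK orbT.
  elim: u {uW uw uK um} => [|v u IH] /=; first by rewrite (length1 LL).
  rewrite word_eval_cat /cost big_cons (le_trans (lengthM LL _ _))// lerD//.
  by rewrite /wt le_max lexx.
Qed.

End FiniteNorm.

(** * Concentration of Lipschitz functions on finite powers *)

Section Averaging.
Context {R : realType} {I T : finType} (t0 : T).
Implicit Types (x y : {ffun I -> T}) (f g : {ffun I -> T} -> R) (i : I).

Definition update x i (a : T) : {ffun I -> T} :=
  [ffun k => if k == i then a else x k].

Definition hamming (J : {set I}) x y : nat := #|[set k in J | x k != y k]|.

Definition hamming_lipschitz (J : {set I}) f :=
  forall x y, `|f x - f y| <= (hamming J x y)%:R.

(** The conditional expectation of [f] with respect to all coordinates but [i]. *)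
Definition average i f x : R := (#|T|%:R)^-1 * \sum_(a : T) f (update x i a).

Let cardT_gt0 : 0 < #|T|%:R :> R.
Proof. by rewrite ltr0n; apply/card_gt0P; exists t0. Qed.

Lemma update_id x i : update x i (x i) = x.
Proof. by apply/ffunP => k; rewrite ffunE; case: eqP => // ->. Qed.

Lemma update_update x i a b : update (update x i a) i b = update x i b.
Proof. by apply/ffunP => k; rewrite !ffunE; case: eqP. Qed.

Lemma average_update i f x a : average i f (update x i a) = average i f x.
Proof. by congr (_ * _); apply: eq_bigr => b _; rewrite update_update. Qed.

Lemma sum_average i f : \sum_x average i f x = \sum_x f x.
Proof.
rewrite -mulr_sumr pair_big/=.
(* [(x, a) |-> (x with a at i, x i)] is an involution *)
pose s (p : {ffun I -> T} * T) := (update p.1 i p.2, p.1 i).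
have sK : involutive s.
  by move=> [x a]; rewrite /s/= update_update update_id ffunE eqxx.
rewrite (reindex s)/=; last by exists s => p _; exact: sK.
under eq_bigr => p _ do rewrite update_update update_id.
rewrite -(pair_big xpredT xpredT (fun x (_ : T) => f x))/= mulr_sumr.
apply: eq_bigr => x _.
by rewrite sumr_const -[f x *+ _]mulr_natl mulrA mulVf ?mul1r// gt_eqF.
Qed.

Lemma average_mull i f g : (forall x a, g (update x i a) = g x) ->
  average i (fun x => f x * g x) =1 (fun x => average i f x * g x).
Proof.
move=> gi x; rewrite /average -mulrA; congr (_ * _).
by rewrite mulr_suml; apply: eq_bigr => a _; rewrite gi.
Qed.

(** Averaging is the orthogonal projection onto the functions that do not depend
    on the coordinate [i]. *)
Lemma average_orthogonal i f g : (forall x a, g (update x i a) = g x) ->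
  \sum_x (f x - average i f x) * g x = 0.
Proof.
move=> gi; under eq_bigr => x _ do rewrite mulrBl.
rewrite sumrB -(sum_average i); apply/eqP; rewrite subr_eq0; apply/eqP.
by apply: eq_bigr => x _; rewrite average_mull.
Qed.

Lemma average_norm_le i f c x :
  (forall a, `|f (update x i a)| <= c) -> `|average i f x| <= c.
Proof.
move=> fc; rewrite /average normrM normfV normr_nat.
rewrite ler_pdivrMl// (le_trans (ler_norm_sum _ _ _))//.
by rewrite mulr_natl -sumr_const; apply: ler_sum.
Qed.

Lemma averageB i f g x :
  average i f x - average i g x = average i (fun y => f y - g y) x.
Proof. by rewrite /average sumrB mulrBr. Qed.

Lemma average_cst i c x : average i (fun=> c) x = c.
Proof. by rewrite /average sumr_const -[c *+ _]mulr_natl mulrA mulVf ?mul1r// gt_eqF. Qed.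

(** Averaging over [i] removes [i] from the coordinates that [f] may depend on. *)
Lemma lipschitz_average (J : {set I}) i f : hamming_lipschitz J f ->
  forall x y, `|average i f x - average i f y| <= (hamming (J :\ i) x y)%:R.
Proof.
move=> Jf x y.
have -> : average i f x - average i f y =
  (#|T|%:R)^-1 * \sum_a (f (update x i a) - f (update y i a)).
  by rewrite sumrB mulrBr.
rewrite normrM normfV normr_nat ler_pdivrMl//.
rewrite (le_trans (ler_norm_sum _ _ _))//.
rewrite mulr_natl -sumr_const; apply: ler_sum => a _.
rewrite (le_trans (Jf _ _))// ler_nat subset_leq_card//.
apply/fintype.subsetP => k; rewrite !inE !ffunE.
by case: (k =P i) => [->|_]; rewrite ?eqxx ?andbF.
Qed.

Lemma dist_average_le1 (J : {set I}) i f : hamming_lipschitz J f ->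
  forall x, `|f x - average i f x| <= 1.
Proof.
move=> Jf x; rewrite -{1}(average_cst i (f x) x) averageB.
apply: average_norm_le => a; rewrite (le_trans (Jf _ _))//.
rewrite -[leRHS]/(1%:R) -(cards1 i) ler_nat subset_leq_card//.
apply/fintype.subsetP => k; rewrite !inE !ffunE.
by case: (k =P i) => // _; rewrite eqxx andbF.
Qed.

(** The Efron-Stein inequality for Lipschitz functions: average over the
    coordinates of [J] one at a time. By orthogonality each step accounts for its
    own part of the variance, at most 1 per point since [f] moves by at most 1
    when a single coordinate changes. After the last step the function is
    constant. *)
Lemma efron_stein (J : {set I}) f : hamming_lipschitz J f ->
  exists c, \sum_x (f x - c) ^+ 2 <= #|J|%:R * #|{ffun I -> T}|%:R.
Proof.
have [m] := ubnP #|J|; elim: m J f => // m IH J f Jm Jf.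
have [J0|[i iJ]] := set_0Vmem J.
  exists (f [ffun=> t0]); rewrite J0 cards0 mul0r big1// => x _.
  have := Jf x [ffun=> t0].
  have -> : hamming J x [ffun=> t0] = 0%N.
    by apply: eq_card0 => k; rewrite !inE J0 finset.in_set0.
  by rewrite normr_le0 => /eqP ->; rewrite expr0n.
have cJ : #|J| = #|J :\ i|.+1 by rewrite (cardsD1 i) iJ.
have [c fc] := IH (J :\ i) (average i f)
  ltac:(by rewrite cJ in Jm) (lipschitz_average i Jf).
exists c.
have -> : \sum_x (f x - c) ^+ 2 = \sum_x (f x - average i f x) ^+ 2 +
    \sum_x (average i f x - c) ^+ 2 +
    2 * \sum_x (f x - average i f x) * (average i f x - c).
  rewrite mulr_sumr -!big_split/=; apply: eq_bigr => x _; ring.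
rewrite average_orthogonal ?mulr0 ?addr0; last first.
  by move=> x a; rewrite average_update.
rewrite cJ -natr1 mulrDl mul1r addrC lerD//.
rewrite -sumr_const ler_sum// => x _.
rewrite -real_normK ?num_real// expr_le1//.
exact: dist_average_le1 Jf x.
Qed.

End Averaging.

(** * A Ramsey theorem for right translations of finite powers *)

Section ShiftRamsey.
Context {I : finType} {Q : finGroupType}.
Implicit Types (h a : {ffun I -> Q}) (t : Q).

Definition rshift h t : {ffun I -> Q} := [ffun k => (h k * t)%g].

Lemma rshiftK t : cancel (rshift^~ t) (rshift^~ (t^-1)%g).
Proof. by move=> h; apply/ffunP => k; rewrite !ffunE mulgK. Qed.

Lemma rshiftVK t : cancel (rshift^~ (t^-1)%g) (rshift^~ t).
Proof. by move=> h; apply/ffunP => k; rewrite !ffunE mulgKV. Qed.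

Definition hdist h a : nat := hamming [set: I] h a.

Lemma hdist_triangle h a b : (hdist h b <= hdist h a + hdist a b)%N.
Proof.
rewrite (leq_trans _ (leq_card_setU _ _))// subset_leq_card//.
apply/fintype.subsetP => k; rewrite !inE.
by case: (h k =P a k) => // ->.
Qed.

Lemma hdistxx h : hdist h h = 0%N.
Proof. by apply: eq_card0 => k; rewrite !inE eqxx. Qed.

Lemma hdistC h a : hdist h a = hdist a h.
Proof. by apply: eq_card => k; rewrite !inE eq_sym. Qed.

Lemma hdist_le h a : (hdist h a <= #|I|)%N.
Proof. exact: max_card. Qed.

(** The Hamming distance to the colour class [i]; the default value [#|I|], the
    diameter, keeps it Lipschitz when the class is empty. *)
Definition class_dist (C : finType) (col : {ffun I -> Q} -> C) (i : C) h :=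
  \big[Order.min/#|I|]_(a | col a == i) hdist h a.

Lemma class_dist_le (C : finType) (col : {ffun I -> Q} -> C) h a :
  (class_dist col (col a) h <= hdist h a)%N.
Proof. by rewrite -leEnat; apply: bigmin_le_cond. Qed.

Lemma class_dist_attained (C : finType) (col : {ffun I -> Q} -> C) h b :
  exists2 a, col a = col b & class_dist col (col b) h = hdist h a.
Proof.
have [a /eqP ca amin] := @arg_minnP _ b [pred a | col a == col b] (hdist h) (eqxx _).
exists a => //; apply/eqP; rewrite eqn_leq -{1}ca class_dist_le/=.
rewrite /class_dist; elim/big_ind: _ => [|x y xa ya|d /amin//].
  exact: hdist_le.
by rewrite minEnat leq_min xa.
Qed.

Lemma class_dist_lipschitz (C : finType) (col : {ffun I -> Q} -> C) i h b :
  (class_dist col i h <= class_dist col i b + hdist h b)%N.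
Proof.
have [[c /eqP ci]|ci] := pselect (exists c, col c == i); last first.
  rewrite /class_dist !big_pred0 ?leq_addr// => c; apply/negbTE/negP => ?;
  by apply: ci; exists c.
have [a ca] := class_dist_attained col b c; rewrite ci => ->.
rewrite addnC (leq_trans _ (hdist_triangle _ _ _))//.
by rewrite -ci -ca class_dist_le.
Qed.

(** [f] is on average close to a constant [c], and a translation permutes the
    points; so [f] and its translate are on average close to each other. *)
Lemma sum_shift_le (R : realType) (f : {ffun I -> Q} -> R) t :
  hamming_lipschitz [set: I] f ->
  \sum_h (f (rshift h t) - f h) ^+ 2 <= 4 * #|I|%:R * #|{ffun I -> Q}|%:R.
Proof.
move=> /(efron_stein 1%g)[c]; rewrite cardsT => fc.
have tc : \sum_h (f (rshift h t) - c) ^+ 2 = \sum_h (f h - c) ^+ 2.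
  rewrite [RHS](reindex (rshift^~ t))//.
  by exists (rshift^~ (t^-1)%g) => h _; [exact: rshiftK|exact: rshiftVK].
apply: (@le_trans _ _ (2 * \sum_h (f (rshift h t) - c) ^+ 2 +
                       2 * \sum_h (f h - c) ^+ 2)); last first.
  by rewrite tc; lra.
rewrite !mulr_sumr -big_split/=; apply: ler_sum => h _.
rewrite -subr_ge0 (_ : _ - _ = (f (rshift h t) + f h - 2 * c) ^+ 2) ?sqr_ge0//.
by ring.
Qed.

End ShiftRamsey.

(** The distances [f i] to the colour classes hardly change under a translation by
    an element of [ts], in mean square over all [h]. For large [n] some [h] is
    therefore good for all [i] and all [t] at once; as [f i h] is 0 for the
    colour [i] of [h] itself, all translates of [h] are close to that class. *)
Lemma shift_ramsey (R : realType) (Q : finGroupType) (C : finType)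
    (ts : seq Q) (eps : R) : 0 < eps ->
  exists2 n, (0 < n)%N & forall col : {ffun 'I_n -> Q} -> C,
    exists h, forall t, t \in ts ->
      exists2 a, col a = col h & (hdist (rshift h t) a)%:R <= eps * n%:R.
Proof.
move=> eps0; pose B : R := 4 * #|C|%:R * (size ts)%:R / eps ^+ 2.
have eps20 : 0 < eps ^+ 2 by rewrite exprn_gt0.
exists (Num.truncn B).+1 => // col; set n := _.+1.
have nB : B < n%:R by exact: truncnS_gt.
absurd_not => H.
pose f i (h : {ffun 'I_n -> Q}) : R := (class_dist col i h)%:R.
have fL i : hamming_lipschitz [set: 'I_n] (f i).
  move=> x y; rewrite ler_distl lerBlDr -!natrD !ler_nat.
  by rewrite class_dist_lipschitz andbT -/(hdist x y) hdistC class_dist_lipschitz.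
have N0 : 0 < #|{ffun 'I_n -> Q}|%:R :> R.
  by rewrite ltr0n; apply/card_gt0P; exists [ffun=> 1%g].
have : #|{ffun 'I_n -> Q}|%:R * (eps * n%:R) ^+ 2 <=
    \sum_(t <- ts) \sum_i \sum_h (f i (rshift h t) - f i h) ^+ 2.
  rewrite mulr_natl -sumr_const.
  under [leRHS]eq_bigr => t _ do rewrite exchange_big.
  rewrite exchange_big/=; apply: ler_sum => h _.
  have [t tts Ht] := H h.
  rewrite (big_rem t)//= (bigD1 (col h))//= -addrA.
  have -> : f (col h) h = 0.
    apply/eqP; rewrite pnatr_eq0 -leqn0.
    by rewrite -[leqRHS](hdistxx h) class_dist_le.
  rewrite subr0 -[leLHS]addr0 lerD//.
    rewrite ler_pXn2r ?nnegrE ?mulr_ge0// ?ltW// ltNge; apply/negP => fle.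
    have [a ca fa] := class_dist_attained col (rshift h t) h.
    by have /negP := Ht _ ca; apply; rewrite -fa.
  by rewrite addr_ge0 ?sumr_ge0// => *; rewrite ?sumr_ge0// => *; rewrite sqr_ge0.
have : \sum_(t <- ts) \sum_i \sum_h (f i (rshift h t) - f i h) ^+ 2 <=
    (size ts)%:R * (#|C|%:R * (4 * n%:R * #|{ffun 'I_n -> Q}|%:R)) :> R.
  rewrite [leRHS]mulr_natl -sum1_size -sumrMnr big_seq [leRHS]big_seq.
  apply: ler_sum => t _; rewrite mulr1n mulr_natl -sumr_const.
  by apply: ler_sum => i _; rewrite (le_trans (sum_shift_le _ (fL i)))// card_ord.
move=> /[swap] /le_trans /[apply].
rewrite -subr_ge0.
have -> : (size ts)%:R * (#|C|%:R * (4 * n%:R * #|{ffun 'I_n -> Q}|%:R)) -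
    #|{ffun 'I_n -> Q}|%:R * (eps * n%:R) ^+ 2 =
    (#|{ffun 'I_n -> Q}|%:R * n%:R * eps ^+ 2) * (B - n%:R) :> R.
  by rewrite /B; field; rewrite gt_eqF.
rewrite pmulr_rge0 ?subr_ge0 ?mulr_gt0// => /le_lt_trans/(_ nB).
by rewrite ltxx.
Qed.

(** * Finite metric subspaces of generalized Urysohn spaces *)

Record is_distance {R : realType} {T : Type} (d : T -> T -> R) : Prop :=
  IsDistance {
    dist_refl : forall x, d x x = 0 ;
    dist_separated : forall x y, d x y = 0 -> x = y ;
    dist_sym : forall x y, d x y = d y x ;
    dist_triangle : forall y x z, d x z <= d x y + d y z
  }.

(** A copy of [T] that carries the metric [d]; the proof [dP] is a parameter so
    that the metric structure can be inferred from the type. *)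
Definition metric_of {R : realType} {T : choiceType} {d : T -> T -> R}
  (dP : is_distance d) : Type := T.

Section MetricOf.
Context {R : realType} {T : choiceType} {d : T -> T -> R} (dP : is_distance d).

HB.instance Definition _ := Choice.copy (metric_of dP) T.
HB.instance Definition _ := isMetric.Build R (metric_of dP)
  (dist_refl dP) (dist_separated dP) (dist_sym dP) (dist_triangle dP).

End MetricOf.

Section Embedding.
Context {R : realType} {U : metricType R} (HU : generalized_Urysohn U).
Local Open Scope classical_set_scope.

(** One point at a time: if [j] embeds [s], then [z :: s] is a one-point extension
    of the subspace [j s] of [U]. *)
Lemma embed_finite (Z : metricType R) (u0 : U) (s : seq Z) :
  exists j : Z -> U, {in s &, forall x y, mdist (j x) (j y) = mdist x y}.
Proof.
elim: s => [|z s [j jP]]; first by exists (fun=> u0) => x.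
have [zs|zs] := boolP (z \in s).
  exists j => x y; rewrite !inE => /predU1P[->|xs] /predU1P[->|ys];
    by apply: jP.
pose A : set U := j @` [set x | x \in s].
have finA : finite_set A by apply: finite_image; exact: finite_seq.
pose A' : set Z := [set x | x \in z :: s].
have zA' : A' z by rewrite /A' /= inE eqxx.
have sA' x : x \in s -> A' x by rewrite /A' /= inE => ->; rewrite orbT.
have /choice[i iP] : forall a : A, exists x : Z, x \in s /\ j x = \val a.
  by move=> a; have [x xs xa] := set_valP a; exists x.
pose i' (a : A) : A' := exist _ (i a) (mem_set (sA' _ (iP a).1)).
pose z' : A' := exist _ z (mem_set zA').
have jI x y : x \in s -> y \in s -> j x = j y -> x = y.
  move=> xs ys xy; apply: mdist_positivity.
  by rewrite -(jP _ _ xs ys) xy mdistxx.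
have [|||k [kI ki]] := HU finA (A' := A' : metricType R) (i := i') (a := z').
- move=> a b; have := jP _ _ (iP a).1 (iP b).1.
  by rewrite (iP a).2 (iP b).2; exact: esym.
- move=> [a _ /(congr1 val)/= iz].
  by move: zs; rewrite -iz (iP a).1.
- apply/seteqP; split=> // x _.
  have := set_valP x; rewrite /A' /= inE => /predU1P[xz|xs].
    by right; apply: val_inj.
  left; have Ax : A (j (val x)) by exists (val x).
  exists (exist (fun y => y \in A) _ (mem_set Ax)) => //; apply: val_inj => /=.
  by apply: jI => //; [exact: (iP _).1|rewrite (iP _).2].
pose j' x := if pselect (A' x) is left xA then k (exist _ x (mem_set xA)) else u0.
exists j' => x y xs ys; rewrite /j'.
case: pselect => // xA; by case: pselect.
Qed.

Lemma embed_finType (T : finType) (d : T -> T -> R) (u0 : U) :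
    is_distance d -> exists j : T -> U, forall x y, mdist (j x) (j y) = d x y.
Proof.
move=> dP; have [j jP] := @embed_finite (metric_of dP) u0 (enum T).
by exists j => x y; rewrite jP// mem_enum.
Qed.

Context (Hhom : omega_homogeneous U).

Lemma extend_isometry (s : seq U) (k : U -> U) :
  {in s &, forall x y, mdist (k x) (k y) = mdist x y} ->
  exists g : Iso U, {in s, g =1 k}.
Proof.
move=> kI; pose A : set U := [set x | x \in s]; pose B : set U := k @` A.
have finA : finite_set A by exact: finite_seq.
have kB x : A x -> B (k x) by move=> Ax; exists x.
pose f (a : A) : B := exist _ (k (val a)) (mem_set (kB _ (set_valP a))).
have fP : isometry_onto f.
  split; first by move=> a b; exact: kI (set_valP a) (set_valP b).
  apply/seteqP; split=> // b _; have [x xs xb] := set_valP b.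
  by exists (exist _ x (mem_set xs)) => //; apply: val_inj.
have [g gI gf] := Hhom finA (finite_image k finA) fP.
exists (mkIso gI) => x xs.
exact: (gf (exist _ x (mem_set (xs : A x)))).
Qed.

Lemma Iso_transitive (x y : U) : exists g : Iso U, g x = y.
Proof.
have [|g gP] := @extend_isometry [:: x] (fun=> y).
  by move=> a b; rewrite !inE => /eqP -> /eqP ->; rewrite !mdistxx.
by exists g; rewrite gP// inE.
Qed.

End Embedding.

(** * The approximate Ramsey property of the isometry group *)

Section MeanDistance.
Context {R : realType} {Q : finGroupType} (N : Q -> R).
Hypotheses (NL : length_function N) (N0 : forall q, N q = 0 -> q = 1%g).
Context {n : nat} (n0 : (0 < n)%N).
Implicit Types x y : {ffun 'I_n -> Q}.

Definition mean_dist x y : R := n%:R^-1 * \sum_i N ((x i)^-1 * y i)%g.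

Let n0R : 0 < n%:R :> R. Proof. by rewrite ltr0n. Qed.

Lemma mean_dist_distance : is_distance mean_dist.
Proof.
split=> [x|x y|x y|y x z]; rewrite /mean_dist.
- by rewrite big1 ?mulr0// => i _; rewrite mulVg (length1 NL).
- move=> /eqP; rewrite mulf_eq0 invr_eq0 gt_eqF//= psumr_eq0; last first.
    by move=> i _; exact: length_ge0.
  move=> /allP xy; apply/ffunP => i.
  have /eqP/N0/(canRL (mulKVg _)) := xy i (mem_index_enum _).
  by rewrite mulg1.
- congr (_ * _); apply: eq_bigr => i _.
  by rewrite -(lengthV NL) invgM invgK.
- rewrite -mulrDr ler_wpM2l ?invr_ge0 ?ler0n// -big_split/=.
  apply: ler_sum => i _; rewrite (le_trans _ (lengthM NL _ _))//.
  by rewrite mulgA mulgK.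
Qed.

Lemma mean_dist_rshift x p q :
  mean_dist (rshift x p) (rshift x q) = N (p^-1 * q)%g.
Proof.
rewrite /mean_dist (eq_bigr (fun=> N (p^-1 * q)%g)); last first.
  by move=> i _; rewrite !ffunE invgM -mulgA mulKg.
by rewrite sumr_const card_ord -[N _ *+ _]mulr_natl mulKf// gt_eqF.
Qed.

Lemma mean_dist_le x y c : (forall q, N q <= c) ->
  mean_dist x y <= n%:R^-1 * ((hdist x y)%:R * c).
Proof.
move=> Nc; rewrite ler_wpM2l ?invr_ge0 ?ler0n//.
rewrite (bigID (fun i => x i == y i))/= big1 ?add0r => [|i /eqP ->]; last first.
  by rewrite mulVg (length1 NL).
apply: (@le_trans _ _ (\sum_(i | x i != y i) c)); first exact: ler_sum.
rewrite sumr_const mulr_natl le_eqVlt; apply/orP; left; apply/eqP; congr (_ *+ _).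
by apply: eq_card => i; rewrite !inE.
Qed.

End MeanDistance.

Lemma hdist_rshift (I : finType) (Q : finGroupType) (x y : {ffun I -> Q}) t :
  hdist (rshift x t) (rshift y t) = hdist x y.
Proof. by apply: eq_card => i; rewrite !inE !ffunE (inj_eq (mulIg t)). Qed.

Lemma positive_lower_bound (R : realType) (r : seq R) (e : R) : 0 < e ->
  exists2 eta, 0 < eta <= e & forall d, d \in r -> 0 < d -> eta <= d.
Proof.
move=> e0; elim: r => [|d r [eta /andP[eta0 etae] etar]].
  by exists e; rewrite ?e0 ?lexx.
have [d0|d0] := ltP 0 d; last first.
  exists eta; first by rewrite eta0.
  by move=> d'; rewrite inE => /predU1P[->|/etar//]; rewrite ltNge d0.
exists (Num.min eta d); first by rewrite lt_min eta0 d0 ge_min etae.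
move=> d'; rewrite inE => /predU1P[-> _|/etar/[apply] ed].
  by rewrite ge_min lexx orbT.
by rewrite ge_min ed.
Qed.

Section IsoRamsey.
Context {R : realType} {U : metricType R}.
Hypotheses (HU : generalized_Urysohn U) (Hhom : omega_homogeneous U).
Implicit Types (x y : U) (f g t : Iso U).

Lemma Iso_mulE f g x : Iso_fun (f * g)%g x = f (g x).
Proof. by []. Qed.

Lemma Iso_oneE x : Iso_fun 1%g x = x.
Proof. by []. Qed.

Lemma Iso_invK f x : f (Iso_fun f^-1%g x) = x.
Proof. by rewrite -Iso_mulE mulgV. Qed.

Lemma displacement_length (x0 : U) :
  length_function (fun g : Iso U => mdist x0 (g x0)).
Proof.
split=> [|g|g h]; first by rewrite Iso_oneE mdistxx.
  by rewrite -(Iso_mdist g) Iso_invK metric_sym.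
rewrite Iso_mulE (le_trans (metric_triangle _ (Iso_fun g x0) _))// lerD2l.
by rewrite Iso_mdist.
Qed.

(** The elements [t] of [ts] and elements [b x] that send a base point [x0] to [x]
    are modelled in a finite group [Q], so that the points [t^-1 x] of [U] become
    the elements [hat (t, x)] of [Q]: distances between distinct points are
    preserved exactly, and elements that stand for the same point are
    [eta]-close. Embed [Q^n], with the mean of the distances of the coordinates,
    in [U]. Each [h] in [Q^n] gives an isometric copy [x |-> h * phi (b x)] of
    [s], hence by homogeneity an isometry [alpha h] and a colour. For the [h]
    given by [shift_ramsey], homogeneity again gives [beta] that sends each point
    [t^-1 x] to (a representative of) [h * hat (t, x)], and this is close to
    [alpha a x] for some [a] of the same colour as [h]. *)
Lemma Iso_ramsey (s : seq U) (delta : R) (C : finType) (c : Iso U -> C)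
    (ts : seq (Iso U)) : 0 < delta ->
  exists (h : Iso U) (i : C), forall t, t \in ts ->
    exists2 a, c a = i & forall x, x \in s -> mdist (Iso_fun (t * h * a^-1)%g x) x < delta.
Proof.
move=> delta0; case: s => [|x0 s0].
  by exists 1%g, (c 1%g) => t _; exists 1%g.
set s := x0 :: s0.
have /choice[b bP] := Iso_transitive Hhom x0.
pose ts' := 1%g :: ts.
pose P := [seq (t, x) | t <- ts', x <- s].
have Pin t x : t \in ts' -> x \in s -> (t, x) \in P.
  by move=> tt' xs; apply/allpairsP; exists (t, x).
pose pt (p : Iso U * U) := Iso_fun (p.1^-1)%g p.2.
pose W (p q : Iso U * U) :=
  [:: (true, b p.2); (false, p.1); (true, q.1); (false, b q.2)].
pose L (g : Iso U) : R := mdist x0 (g x0).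
have LW p q : L (word_eval id (W p q)) = mdist (pt p) (pt q).
  rewrite /L /word_eval /= /letter /= !Iso_mulE Iso_oneE bP.
  by rewrite -(Iso_mdist (b p.2)) Iso_invK bP -(Iso_mdist p.1^-1%g)
    -(Iso_mulE p.1^-1%g p.1) mulVg.
(* [eta] below all positive distances: then [max d eta] is [d] for those. *)
have [eta /andP[eta0 etad] etaP] := positive_lower_bound
  [seq mdist (pt p) (pt q) | p <- P, q <- P] (ltac:(by rewrite divr_gt0) : 0 < delta / 2).
have [Q [phi [N [NL N0 NP]]]] := finite_norm (displacement_length x0)
  [seq W p q | p <- P, q <- P] eta0.
pose hat (p : Iso U * U) := ((phi p.1)^-1 * phi (b p.2))%g.
(* The words [W p q] evaluate to [hat p]^-1 [hat q]. *)
have {}NP p q : p \in P -> q \in P ->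
    mdist (pt p) (pt q) <= N ((hat p)^-1 * hat q)%g <=
    Num.max (mdist (pt p) (pt q)) eta.
  move=> pP qP; rewrite -LW.
  have -> : ((hat p)^-1 * hat q)%g = word_eval phi (W p q).
    by rewrite /hat invgM invgK /word_eval /= /letter /= mulg1 !mulgA.
  by apply: NP; apply/allpairsP; exists (p, q).
have N_eta p q : p \in P -> q \in P -> pt p = pt q ->
    N ((hat p)^-1 * hat q)%g <= eta.
  move=> pP qP pq; have /andP[_] := NP _ _ pP qP.
  by rewrite pq mdistxx max_r// ltW.
have N_exact p q : p \in P -> q \in P -> pt p != pt q ->
    N ((hat p)^-1 * hat q)%g = mdist (pt p) (pt q).
  move=> pP qP pq; apply/eqP; rewrite eq_le andbC; have := NP _ _ pP qP.
  rewrite max_l// etaP ?mdist_gt0//.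
  by apply/allpairsP; exists (p, q).
pose D := 1 + \sum_q N q.
have ND q : N q <= D.
  rewrite /D (bigD1 q)//= addrCA lerDl addr_ge0 ?sumr_ge0// => *.
  exact: length_ge0.
have D0 : 0 < D.
  by rewrite /D ltr_pwDl ?sumr_ge0// => *; exact: length_ge0.
pose eps := delta / (4 * D).
have eps0 : 0 < eps by rewrite divr_gt0 ?mulr_gt0.
have [n n0 shift] := shift_ramsey C [seq (phi t)^-1%g | t <- ts'] eps0.
have [j jP] := embed_finType HU x0 (mean_dist_distance NL N0 n0).
have /choice[alpha alphaP] : forall h : {ffun 'I_n -> Q}, exists g : Iso U,
    {in s, g =1 fun x => j (rshift h (phi (b x)))}.
  move=> h; apply: (extend_isometry Hhom) => x y xs ys.
  have [->|xy] := eqVneq x y; first by rewrite !mdistxx.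
  rewrite jP mean_dist_rshift//.
  have := @N_exact (1%g, x) (1%g, y) (Pin _ _ (mem_head _ _) xs)
    (Pin _ _ (mem_head _ _) ys).
  rewrite /pt /hat /= invg1 !Iso_oneE => /(_ xy) <-.
  by rewrite invgM invgK -mulgA mulKVg.
have [h hP] := shift (fun h => c (alpha h)^-1%g).
(* A point may be [pt p] for several [p]; [r] picks one of them. *)
have /choice[r rP] : forall z, exists p, z \in map pt P -> p \in P /\ pt p = z.
  move=> z; have [/mapP[p pP zp]|zP] := boolP (z \in map pt P).
    by exists p.
  by exists (1%g, x0).
have [beta betaP] : exists g : Iso U,
    {in map pt P, g =1 fun z => j (rshift h (hat (r z)))}.
  apply: (extend_isometry Hhom) => x y xP yP.
  have [->|xy] := eqVneq x y; first by rewrite !mdistxx.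
  have [rx ptx] := rP _ xP; have [ry pty] := rP _ yP.
  by rewrite jP mean_dist_rshift// N_exact ?ptx ?pty.
exists beta^-1%g, (c (alpha h)^-1%g) => t tts.
have tts' : t \in ts' by rewrite inE tts orbT.
have [a ca ha] := hP _ (map_f _ tts').
exists (alpha a)^-1%g => // x xs.
have xP : pt (t, x) \in map pt P by apply: map_f; exact: Pin.
have [rx ptx] := rP _ xP.
have -> : mdist (Iso_fun (t * beta^-1 * (alpha a)^-1^-1)%g x) x =
    mdist (alpha a x) (beta (pt (t, x))).
  rewrite invgK !Iso_mulE -(Iso_mdist t^-1%g) -(Iso_mulE t^-1%g t) mulVg Iso_oneE.
  by rewrite -(Iso_mdist beta) Iso_invK.
rewrite alphaP// betaP// jP.
have dP := mean_dist_distance NL N0 n0.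
rewrite (le_lt_trans (dist_triangle dP (rshift h (hat (t, x))) _ _))//.
rewrite mean_dist_rshift//.
have := N_eta _ _ (Pin _ _ tts' xs) rx (esym ptx).
have -> : rshift h (hat (t, x)) = rshift (rshift h (phi t)^-1%g) (phi (b x)).
  by apply/ffunP => k; rewrite !ffunE mulgA.
rewrite (dist_sym dP) => Nle.
have := mean_dist_le NL (rshift (rshift h (phi t)^-1%g) (phi (b x)))
  (rshift a (phi (b x))) ND.
rewrite hdist_rshift.
have : n%:R^-1 * ((hdist (rshift h (phi t)^-1%g) a)%:R * D) <= delta / 4.
  rewrite mulrA -ler_pdivlMr// ler_pdivrMl ?ltr0n// mulrC.
  rewrite (_ : delta / 4 / D = eps)//.
  by rewrite /eps invfM mulrA.
by move=> /[swap] /le_trans /[apply]; move: delta0 => ? ?; lra.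
Qed.

End IsoRamsey.

(** * From the Ramsey property to fixed points *)

Section FixedPoint.
Local Open Scope classical_set_scope.

Definition displaces_little {R : realType} {U : metricType R} (s : seq U)
    (delta : R) : set (Iso U) :=
  [set u | forall x, x \in s -> mdist (u x) x < delta].

(** The supersets of the sets [displaces_little s delta] form a filter, which
    converges pointwise to the identity. *)
Lemma nbhs_Iso1 (R : realType) (U : metricType R) (V : set (Iso U)) :
    nbhs (1%g : Iso U) V ->
  exists s delta, 0 < delta /\ displaces_little s delta `<=` V.
Proof.
pose F : set_system (Iso U) := [set V | exists s delta,
  0 < delta /\ displaces_little s delta `<=` V].
have FF : Filter F.
  split.
  - by exists [::], 1.
  - move=> A B [s [d [d0 sA]]] [s' [d' [d'0 sB]]].
    exists (s ++ s'), (Num.min d d'); rewrite lt_min d0 d'0; split=> // u su.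
    split; [apply: sA|apply: sB] => x xs.
      by have := su x; rewrite mem_cat xs lt_min => /(_ isT)/andP[].
    by have := su x; rewrite mem_cat xs orbT lt_min => /(_ isT)/andP[].
  - by move=> A B AB [s [d [d0 sA]]]; exists s, d; split=> //; exact: subset_trans AB.
suff F1 : F --> (1%g : Iso U) by exact: F1.
apply/Iso_cvgP => x; apply/metricType_numDomainType.cvgrPdist_lt => e e0.
exists [:: x], e; split=> // u; rewrite /displaces_little/= => /(_ x (mem_head _ _)).
by rewrite metric_sym.
Qed.

(** [W] is a neighbourhood of [x] that is disjoint from its translate by [g]; the
    continuity of the action at [(1, x)] gives room for a small error [u]. *)
Lemma moved_point_nbhs (G : topologicalGroupType) (X : topologicalType)
    (act : G -> X -> X) (x : X) (g : G) :
    hausdorff_space X -> continuous_action act -> act g x <> x ->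
  exists (V : set G) (W' W : set X),
    [/\ nbhs 1%g V, open W', W' x,
        (forall u y, V u -> W' y -> W (act u y)) &
        (forall y, W y -> ~ W (act g y))].
Proof.
move=> hX [act1 actM act_cts] /eqP gx.
move: hX; rewrite open_hausdorff => /(_ _ _ gx)[[A B]/= [gxA xB]] [Ao Bo AB0].
have cg : continuous (act g).
  move=> y; have cp : (fun z => (g, z)) @ y --> (g, y).
    by apply: cvg_pair; [exact: cvg_cst|exact: cvg_id].
  exact: (cvg_comp _ _ cp (act_cts (g, y))).
pose W := B `&` act g @^-1` A.
have Wx : nbhs x W.
  apply: filterI; first by apply: open_nbhs_nbhs; split=> //; rewrite inE in xB.
  by apply: cg; apply: open_nbhs_nbhs; split=> //; rewrite inE in gxA.
have := act_cts (1%g, x) W; rewrite /= act1 => /(_ Wx)[[V W'] /= [V1 W'x] VW].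
exists V, W'^°, W; split=> //.
- exact: open_interior.
- by move=> u y Vu /interior_subset W'y; exact: (VW (u, y)).
- move=> y [_ Agy] [Bgy _].
  by have : (A `&` B) (act g y) by []; rewrite (eqP AB0).
Qed.

(** The base points of the members of a finite subcover. *)
Lemma compact_seq_cover (X : topologicalType) (W : X -> set X) :
    compact [set: X] -> (forall x, open (W x)) -> (forall x, W x x) ->
  exists D : seq X, forall y, exists2 x, x \in D & W x y.
Proof.
move=> cX Wo Wx; have [[x0 _]|noX] := pselect (exists x : X, True); last first.
  by exists [::] => y; case: noX; exists y.
(* The covering characterization of compactness requires a base point. *)
pose Xp : ptopologicalType := HB.pack (X : Type) X (isPointed.Build X x0).
have : @cover_compact Xp [set: Xp] by rewrite -compact_cover; exact: cX.
move=> /(_ X [set: X] W)[|x _|D _ DX]; first by move=> x _; exact: Wo.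
  by exists x.
by exists (finmap.enum_fset D) => y; have [x xD Wxy] := DX y I; exists x.
Qed.

End FixedPoint.

Theorem theorem6p6 (R : realType) (U : metricType R)
    (HU : generalized_Urysohn U) (Hhom : omega_homogeneous U) :
  fixed_point_on_compacta (Iso U).
Proof.
move=> X [x0 _] Xcpt Xhaus act actP; apply: contrapT => nofix.
have moved x : exists (p : Iso U * (set (Iso U) * (set X * set X))),
    [/\ nbhs 1%g p.2.1, open p.2.2.1, p.2.2.1 x,
        (forall u y, p.2.1 u -> p.2.2.1 y -> p.2.2.2 (act u y)) &
        (forall y, p.2.2.2 y -> ~ p.2.2.2 (act p.1 y))].
  have [g gx] : exists g, act g x <> x.
    apply: contrapT => /forallNP fx; apply: nofix; exists x => g.
    by apply: contrapT; exact: fx.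
  have [V [W' [W H]]] := moved_point_nbhs Xhaus actP gx.
  by exists (g, (V, (W', W))).
have {moved} /choice[p /all_and5[V1 W'o W'x VW gW]] := moved.
have [D DX] := compact_seq_cover Xcpt W'o W'x.
have [|s [delta [delta0 sV]]] :=
  @nbhs_Iso1 R U [set u | forall x, x \in D -> (p x).2.1 u]%classic.
  elim: D {DX} => [|x D IH]; first by apply: filterS filterT => u _ x.
  apply: filterS (filterI (V1 x) IH) => u [ux uD] y.
  by rewrite inE => /predU1P[->|/uD].
(* Colour an isometry [h] by a member of the finite subcover that contains
   [h x0]. *)
have /choice[c cP] : forall h, exists i : seq_sub D, (p (val i)).2.2.1 (act h x0).
  move=> h; have [x xD Wx] := DX (act h x0).
  by exists (SeqSub xD).
have [h [i hP]] := Iso_ramsey HU Hhom s c (1%g :: [seq (p x).1 | x <- D]) delta0.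
(* All of [h x0], [g_1 h x0], ..., [g_m h x0] are in the same [W_i]. *)
have thW t : t \in 1%g :: [seq (p x).1 | x <- D] ->
    (p (val i)).2.2.2 (act (t * h)%g x0).
  move=> /hP[a ca /sV/(_ (val i) (valP i)) Vu].
  have [_ actM _] := actP.
  rewrite -[(t * h)%g](mulgKV a) actM; apply: VW => //.
  by rewrite -ca; exact: cP.
have [_ actM _] := actP.
apply: (gW (val i) (act h x0)).
  by have := thW 1%g (mem_head _ _); rewrite mul1g.
rewrite -actM; apply: thW; rewrite inE; apply/orP; right.
by apply: (map_f (fun x => (p x).1)); exact: valP i.
Qed.
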